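(* Let $f(x)\in\mathbb{Z}[x]$ be a positive polynomial. Then there exists a unique least positive integer $a$ and a unique base-$x$ representation of $f(x)$ as follows: $$f(x)=b_0(x)\,1+b_1(x)\,x+b_2(x)\,x^2+\cdots+b_m(x)\,x^m,$$ with $$b_i(x)\in\{0,1,\dots,a-1\}\cup\{x-1,\dots,x-a\},\qquad b_m(x)\neq 0.$$ In particular, the unique representation of $f(b)\in\mathbb{N}$ in base $b$ for all $b\ge a$ is given by $$f(b)=[\,b_m(b)\cdots b_1(b)\,b_0(b)\,]_b.$$
   Context: $\mathbb{N}$ is the set of positive integers. A polynomial $f(x)\in\mathbb{Z}[x]$ is called positive if it has positive values for $x\ge k$ for some $k\in\mathbb{Z}$, that is, if it has a positive leading coefficient. The notation $[d_m\cdots d_1d_0]_b$ stands for the base-$b$ expansion $\sum_{i=0}^m d_i b^i$ with digits $d_i$ between $0$ and $b-1$. In a base-$x$ representation, the ''coefficients'' $b_i(x)$ are digits from the infinite alphabet consisting of the constant digits $0,1,2,\dots$ and the linear digits $x-1,x-2,\dots$.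
   Formalization: At b = a, f(b) may be 0 (f = x-2, a = 2) or b_m(b) may vanish, so f(b) ∈ ℕ is replaced by f(b) ≥ 0 for b ≥ a, with the base-b expansion unique up to leading zeros; f(b) > 0 and b_m(b) ≠ 0 are claimed only for b > a. *)

(* Defs.v *)
From mathcomp Require Export all_boot all_order all_algebra.

Set Implicit Arguments.
Unset Strict Implicit.
Unset Printing Implicit Defensive.

Import GRing.Theory Num.Theory.
Local Open Scope ring_scope.

Definition positive_poly (f : {poly int}) : Prop :=
  exists k : int, forall x : int, k <= x -> 0 < f.[x].

Definition alphabet (a : nat) : seq {poly int} :=
  [seq k%:Z%:P | k <- iota 0 a] ++ [seq 'X - k%:Z%:P | k <- iota 1 a].

(* The digit of index i is listed at position i (least significant first).
   As [last 0 [::] = 0], the last conjunct forces the list to be nonempty. *)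
Definition base_x_repr (a : nat) (f : {poly int}) (s : seq {poly int}) : Prop :=
  [/\ all (mem (alphabet a)) s,
      f = \sum_(i < size s) s`_i * 'X^i
    & last 0 s != 0].

Definition has_base_x_repr (f : {poly int}) (a : nat) : Prop :=
  (0 < a)%N /\ exists s, base_x_repr a f s.

Definition least_such (P : nat -> Prop) (a : nat) : Prop :=
  P a /\ forall a', P a' -> (a <= a')%N.

(* n = [d_m ... d_1 d_0]_b, leading zeros being allowed. *)
Definition base_expansion (b : nat) (n : int) (d : seq int) : Prop :=
  all (fun x => 0 <= x < b%:Z) d /\ n = \sum_(i < size d) d`_i * b%:Z ^+ i.

(* Uniqueness is up to leading zeros: positions beyond the length read as 0. *)
Definition unique_base_expansion (b : nat) (n : int) (d : seq int) : Prop :=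
  base_expansion b n d /\
  forall e, base_expansion b n e -> forall i, e`_i = d`_i.

(* Main.v *)
(* The digits of [alphabet a] have pairwise distinct constant terms -a, ..., a-1,
   so reduction modulo 'X determines the lowest digit of f, and a representation
   does not depend on the alphabet it is drawn from. For existence write
   f = c + 'X * g. If c >= 0, use the digit c and go on with g; if c < 0, use the
   digit 'X + c and go on with g - 1. Since f is eventually nonnegative, so is the
   new polynomial, and its degree has dropped. *)
Require Import Defs.
From mathcomp Require Import zify.

Set Implicit Arguments.
Unset Strict Implicit.
Unset Printing Implicit Defensive.

Import Order.TTheory GRing.Theory Num.Theory.
Local Open Scope ring_scope.

Lemma sum_digits_head (R : comNzRingType) (x : R) (s : seq R) :
  \sum_(i < size s) s`_i * x ^+ i =
  s`_0 + x * \sum_(i < size (behead s)) (behead s)`_i * x ^+ i.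
Proof.
case: s => [|d s] /=; first by rewrite !big_ord0 mulr0 addr0.
rewrite big_ord_recl expr0 mulr1 mulr_sumr; congr (_ + _).
by apply: eq_bigr => i _; rewrite /= exprS mulrCA.
Qed.

(** Digits satisfying [P] that agree modulo [x] are equal, so the heads coincide; cancelling them
    and one factor [x] leaves the same situation for the tails. It serves both 'X in the polynomials
    and [b] in the integers. Exhausted lists read as 0, whence [P 0]. *)
Lemma digits_inj (R : idomainType) (x : R) (P : pred R) (s t : seq R) :
    x != 0 -> P 0 ->
    (forall u v r, P u -> P v -> u = v + x * r -> u = v) ->
    all P s -> all P t ->
    \sum_(i < size s) s`_i * x ^+ i = \sum_(i < size t) t`_i * x ^+ i ->
  forall i, s`_i = t`_i.
Proof.
move=> x0 P0 Pinj Ps Pt est i.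
have eq_head u v A B : P u -> P v -> u + x * A = v + x * B -> u = v.
  by move=> Pu Pv e; apply: (Pinj u v (B - A)) => //; rewrite mulrBr addrA -e addrK.
have P_head u : all P u -> P u`_0 by case: u => //= d u /andP[].
have P_tail u : all P u -> all P (behead u) by case: u => //= d u /andP[].
elim: i s t Ps Pt est => [|i IHi] s t Ps Pt.
all: rewrite sum_digits_head [RHS]sum_digits_head => est.
all: have est0 := eq_head _ _ _ _ (P_head s Ps) (P_head t Pt) est.
- by [].
- rewrite -!nth_behead; apply: IHi; [exact: P_tail | exact: P_tail |].
  by move: est; rewrite est0 => /addrI/(mulfI x0).
Qed.

Lemma alphabetP (a : nat) (p : {poly int}) :
  reflect ((exists2 k, (k < a)%N & p = k%:Z%:P) \/
           (exists2 k, (0 < k <= a)%N & p = 'X - k%:Z%:P))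
          (p \in alphabet a).
Proof.
rewrite mem_cat; apply: (iffP orP) => -[] => [/mapP[k]|/mapP[k]|[k ka ->]|[k ka ->]].
- by rewrite mem_iota => ka ->; left; exists k.
- by rewrite mem_iota => ka ->; right; exists k => //; lia.
- by left; apply: map_f; rewrite mem_iota.
- by right; apply: (map_f (fun k : nat => 'X - k%:Z%:P)); rewrite mem_iota; lia.
Qed.

Lemma alphabet_mono (a a' : nat) :
  (a <= a')%N -> {subset alphabet a <= alphabet a'}.
Proof.
move=> le p /alphabetP[[k ka ->]|[k ka ->]]; apply/alphabetP.
- by left; exists k => //; lia.
- by right; exists k => //; lia.
Qed.

Lemma alphabet_inj_modX (a : nat) (p q r : {poly int}) :
  p \in alphabet a -> q \in alphabet a -> p = q + 'X * r -> p = q.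
Proof.
move=> pa qa /(congr1 (horner^~ 0)); rewrite !hornerE.
by case/alphabetP: pa => -[k ka ->]; case/alphabetP: qa => -[l la ->];
  rewrite !hornerE => e;
  [have -> : k = l by lia | exfalso; lia | exfalso; lia | have -> : k = l by lia].
Qed.

Lemma eq_nth_last (R : nmodType) (s t : seq R) :
  last 0 s != 0 -> last 0 t != 0 -> (forall i, s`_i = t`_i) -> s = t.
Proof.
(* The top entry of [v] is nonzero, so [u] must reach that position. *)
have le (u v : seq R) : last 0 v != 0 -> (forall i, u`_i = v`_i) -> (size v <= size u)%N.
  move=> v0 euv; rewrite leqNgt; apply: contra v0 => ltuv.
  by rewrite -nth_last -euv nth_default // -ltnS (ltn_predK ltuv).
move=> s0 t0 est; apply: (@eq_from_nth _ 0) => //.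
by apply/eqP; rewrite eqn_leq !le.
Qed.

Lemma base_x_repr_inj (f : {poly int}) (a a' : nat) (s s' : seq {poly int}) :
  (0 < a)%N -> base_x_repr a f s -> base_x_repr a' f s' -> s = s'.
Proof.
move=> a0 [sa fs s0] [sa' fs' s0']; apply: eq_nth_last => //.
pose A := alphabet (maxn a a').
apply: (@digits_inj _ 'X (mem A)).
- by rewrite polyX_eq0.
- by apply/alphabetP; left; exists 0%N => //; lia.
- exact: alphabet_inj_modX.
- by apply: sub_all sa; apply: alphabet_mono; lia.
- by apply: sub_all sa'; apply: alphabet_mono; lia.
- by rewrite -fs -fs'.
Qed.

(** Strict positivity would not survive the recursion, whose quotients end at 0. *)
Definition eventually_nonneg (f : {poly int}) : Prop :=
  exists k : int, forall x : int, k <= x -> 0 <= f.[x].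

(** Take x > |c|, so that x * g(x) >= -c. If c >= 0, then x * g(x) > -x, so the integer g(x) exceeds
    -1; if c < 0, then x * g(x) > 0, so g(x) >= 1. *)
Lemma eventually_nonneg_quotient (g : {poly int}) (c : int) :
  eventually_nonneg (g * 'X + c%:P) ->
  eventually_nonneg (if 0 <= c then g else g - 1).
Proof.
move=> [k fk]; exists (`|k| + `|c| + 1) => x xk.
have := fk x; rewrite !hornerE => /(_ ltac:(lia)) fx.
have [x0 xc] : 0 < x /\ c < x by lia.
case: ifP => c0; rewrite ?hornerE; move: fx; move: g.[x] => y; clear -x0 xc c0; nia.
Qed.

(** The default 1 in [last 1 s] admits the empty list, which represents 0 and ends the recursion; on
    nonempty lists the default is immaterial. *)
Lemma digits_exist (f : {poly int}) :
  eventually_nonneg f ->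
  exists (a : nat) (s : seq {poly int}),
    [/\ (0 < a)%N, all (mem (alphabet a)) s,
        f = \sum_(i < size s) s`_i * 'X^i & last 1 s != 0].
Proof.
have [n] := ubnP (size f); elim: n f => // n IHn f.
have [-> _ _|f0] := eqVneq f 0.
  by exists 1%N, [::]; split; rewrite ?big_ord0 ?oner_eq0.
elim/poly_ind: f f0 => [|g c _] f0 szf fnneg; first by rewrite eqxx in f0.
have := eventually_nonneg_quotient fnneg.
set h := if _ then _ else _ => hnneg.
pose d : {poly int} := if 0 <= c then c%:P else 'X + c%:P.
have fE : g * 'X + c%:P = d + 'X * h.
  rewrite /d /h; case: ifP => _; first by rewrite addrC mulrC.
  by rewrite mulrBr mulr1 [RHS]addrC addrA subrK mulrC.
have szh : (size h < n)%N.
  move: szf; rewrite size_MXaddC.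
  have -> : (g == 0) && (c == 0) = false.
    by apply: contraNF f0 => /andP[/eqP-> /eqP->]; rewrite mul0r addr0.
  rewrite ltnS; rewrite /h; case: ifP => c0 // szg.
  (* If g = 0, then [h] would be -1, which is never nonnegative. Otherwise subtracting 1 does not
     raise the size. *)
  have [g0|g0] := eqVneq g 0.
    case: hnneg => k; rewrite /h c0 g0 => /(_ k (lexx _)).
    by rewrite !hornerE.
  apply: leq_ltn_trans (size_polyD _ _) _.
  by rewrite size_polyN size_poly1 gtn_max szg; move: g0; rewrite -size_poly_gt0; lia.
have [a [s [a0 sa hs s0]]] := IHn h szh hnneg.
(* A constant digit c must lie strictly below the bound, and 'X + c needs |c| at most the bound; |c|
   + 1 covers both. *)
exists (maxn a `|c|.+1), (d :: s); split.
- by lia.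
- apply/andP; split; last by apply: sub_all sa; apply: alphabet_mono; lia.
  apply/alphabetP; rewrite /d; case: ifP => c0.
    by left; exists `|c|%N; [lia | congr (_%:P); lia].
  by right; exists `|c|%N; [lia | rewrite -polyCN; congr (_ + _%:P); lia].
- by rewrite sum_digits_head /= -hs.
(* With an empty tail, [d] is the whole nonzero polynomial. *)
- case: s s0 hs {sa} => //= _; rewrite big_ord0 => h0.
  by move: f0; rewrite fE h0 mulr0 addr0.
Qed.

Lemma has_least_base_x_repr (f : {poly int}) :
  f != 0 -> eventually_nonneg f -> exists a, least_such (has_base_x_repr f) a.
Proof.
move=> f0 /digits_exist[a [s [a0 sa fs sl]]].
have s0 : last 0 s != 0.
  by case: s sl fs {sa} => //= _ fs; rewrite fs big_ord0 eqxx in f0.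
(* Every representation, over any alphabet, equals [s]. So the least bound is the least n whose
   alphabet contains the digits of [s], a decidable condition. *)
pose Q n := (0 < n)%N && all (mem (alphabet n)) s.
have QP n : has_base_x_repr f n -> Q n.
  case=> n0 [t tn]; rewrite /Q n0.
  by rewrite (base_x_repr_inj (s' := t) a0 (And3 sa fs s0) tn); case: tn.
have exQ : exists n, Q n by exists a; rewrite /Q a0.
case: (ex_minnP exQ) => m /andP[m0 sm] minm; exists m; split=> [|n /QP/minm//].
by split=> //; exists s.
Qed.

Lemma alphabet_eval_bounds (a b : nat) (p : {poly int}) :
  (a <= b)%N -> p \in alphabet a -> 0 <= p.[b%:Z] < b%:Z.
Proof. by move=> ab /alphabetP[] [k ka ->]; rewrite !hornerE; lia. Qed.

(** The inequality is strict because the digit 'X - a vanishes at b = a. *)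
Lemma alphabet_eval_neq0 (a b : nat) (p : {poly int}) :
  (a < b)%N -> p \in alphabet a -> p != 0 -> p.[b%:Z] != 0.
Proof.
move=> ab /alphabetP[] [k ka ->]; rewrite !hornerE ?polyC_eq0 //.
by move=> _; lia.
Qed.

Lemma base_expansion_ge0 (b : nat) (n : int) (d : seq int) :
  base_expansion b n d -> 0 <= n.
Proof.
case=> /(all_nthP 0) db ->; apply: sumr_ge0 => i _.
by rewrite mulr_ge0 ?exprn_ge0 //; case/andP: (db i (ltn_ord i)).
Qed.

Lemma base_expansion_unique (b : nat) (n : int) (d : seq int) :
  (0 < b)%N -> base_expansion b n d -> unique_base_expansion b n d.
Proof.
move=> b0 nd; split=> // e [eb ne]; case: nd => db nd.
apply: (@digits_inj _ b%:Z (fun x => 0 <= x < b%:Z)); rewrite -?ne -?nd //.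
- by lia.
- by move=> u v r ub vb uv; rewrite -(modz_small ub) uv addrC mulrC modzMDl modz_small.
Qed.

Lemma base_expansion_gt0 (b : nat) (n : int) (d : seq int) :
  (0 < b)%N -> base_expansion b n d -> last 0 d != 0 -> 0 < n.
Proof.
move=> b0 nd d0; rewrite lt_def (base_expansion_ge0 nd) andbT.
apply: contra d0 => /eqP n0.
(* The empty list also expands 0, so by uniqueness all digits of [d] would vanish. *)
case: (base_expansion_unique b0 nd) => _ /(_ [::]) uniq.
rewrite -nth_last -uniq ?nth_nil //.
by split; rewrite // big_ord0.
Qed.

Lemma base_x_repr_eval (a b : nat) (f : {poly int}) (s : seq {poly int}) :
  (a <= b)%N -> base_x_repr a f s ->
  base_expansion b f.[b%:Z] [seq p.[b%:Z] | p <- s].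
Proof.
move=> ab [sa fs _]; split.
  by rewrite all_map; apply: sub_all sa => p; apply: alphabet_eval_bounds.
rewrite fs horner_sum size_map; apply: eq_bigr => i _.
by rewrite hornerM hornerXn (nth_map 0).
Qed.

Theorem theorem3 (f : {poly int}) (hf : positive_poly f) :
  exists (a : nat) (s : seq {poly int}),
    [/\ unique (least_such (has_base_x_repr f)) a,
        unique (base_x_repr a f) s
      & forall b : nat, (a <= b)%N ->
          let d := [seq p.[b%:Z] | p <- s] in
          [/\ 0 <= f.[b%:Z],
              unique_base_expansion b f.[b%:Z] d
            & (a < b)%N -> 0 < f.[b%:Z] /\ last 0 d != 0]].
Proof.
case: hf => k fk.
have f0 : f != 0.
  by apply: contraTneq (fk k (lexx k)) => ->; rewrite horner0 ltxx.
have [|a la] := has_least_base_x_repr f0.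
  by exists k => x /fk/ltW.
have [[a0 [s sa]] mina] := la; exists a, s; split.
- split=> // a' [ha' mina']; apply/eqP.
  by rewrite eqn_leq mina // mina' //; case: la.
- by split=> // t; apply: (base_x_repr_inj a0 sa).
- move=> b ab d; have fd := base_x_repr_eval ab sa.
  have b0 : (0 < b)%N by lia.
  split; [exact: base_expansion_ge0 fd | exact: base_expansion_unique |].
  move=> ltab; have d0 : last 0 d != 0.
    (* Writing the default 0 as the value of the zero polynomial lets [last] commute with
       evaluation. *)
    case: sa => sa _ s0; rewrite /d -[X in last X _](horner0 b%:Z) (last_map (horner^~ b%:Z)).
    apply: (alphabet_eval_neq0 ltab _ s0).
    case: s s0 sa {fd d} => [|p s]; rewrite /= ?eqxx // => _ /(@allP _ _ (p :: s)).
    by apply; exact: mem_last.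
  by split=> //; apply: base_expansion_gt0 fd d0.
Qed.
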